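(* Let $(\Omega,\Sigma,\mu;\phi)$ be a measure preserving dynamical system with associated Perron-Frobenius operator $P$ on $L^1(\Omega,\Sigma,\mu)$. Then the following are equivalent: (i) $P$ is exact, i.e. $\lim_{n\to\infty}P^nf=\bigl(\int_\Omega f\,d\mu\bigr)\mathbf{1}$ in $L^1$ for each $f\in L^1(\Omega,\Sigma,\mu)$. (ii) For each $B\in\Sigma$, \[\lim_{n\to\infty}\sup_{A\in\Sigma}\bigl|\mu(\phi^{-n}(A)\cap B)-\mu(A)\mu(B)\bigr|=0.\] (iii) For each $B\in\Sigma$ there exists $D\in\Sigma$ with $\mu(D)>0$ such that \[\lim_{n\to\infty}\sup_{A\in\Sigma_D}\bigl|\mu(\phi^{-n}(A)\cap B)-\mu(A)\mu(B)\bigr|=0,\] where $\Sigma_D=\{A\cap D:A\in\Sigma\}$.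
   Context: A measure preserving dynamical system $(\Omega,\Sigma,\mu;\phi)$ is a probability space with a measurable map $\phi\colon\Omega\to\Omega$ such that $\mu(\phi^{-1}(A))=\mu(A)$ for all $A\in\Sigma$. The Perron-Frobenius operator $P$ is the unique linear positive operator on $L^1(\Omega,\Sigma,\mu)$ with $\int_A Pf\,d\mu=\int_{\phi^{-1}(A)}f\,d\mu$ for all $f\in L^1$, $A\in\Sigma$. $\mathbf{1}$ is the constant function one. *)

(* Defs.v *)
From HB Require Import structures.
From mathcomp Require Import all_boot all_order all_algebra.
From mathcomp Require Import all_classical all_reals all_analysis.
Set Implicit Arguments. Unset Strict Implicit. Unset Printing Implicit Defensive.
Import Order.TTheory GRing.Theory Num.Theory.
Import numFieldNormedType.Exports.
Local Open Scope classical_set_scope.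
Local Open Scope ring_scope.

Definition measure_preserving {d} {T : measurableType d} {R : realType}
  (mu : set T -> \bar R) (phi : T -> T) : Prop :=
  measurable_fun setT phi /\
  forall A, measurable A -> mu (phi @^-1` A) = mu A.

(* P is the Perron-Frobenius operator of phi on L^1(mu), acting on
   representatives: it maps integrable functions to integrable functions and
   int_A Pf = int_{phi^-1 A} f for all measurable A.  This determines Pf
   uniquely up to mu-a.e. equality (and then P is linear and positive). *)
Definition is_perron_frobenius {d} {T : measurableType d} {R : realType}
  (mu : set T -> \bar R) (phi : T -> T) (P : (T -> R) -> (T -> R)) : Prop :=
  forall f : T -> R, mu.-integrable setT (EFin \o f) ->
    mu.-integrable setT (EFin \o P f) /\
    forall A, measurable A ->
      (\int[mu]_(x in A) (P f x)%:E = \int[mu]_(x in phi @^-1` A) (f x)%:E)%E.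

(* Main.v *)
Require Import Defs.
From HB Require Import structures.
From mathcomp Require Import all_boot all_order all_algebra.
From mathcomp Require Import all_classical all_reals all_analysis.
From mathcomp Require Import measurable_realfun ring lra.
Import Order.TTheory GRing.Theory Num.Theory.
Import numFieldNormedType.Exports.
Local Open Scope classical_set_scope.
Local Open Scope ring_scope.

(* Condition (iii) is only needed for tail events E, those of the form
   phi^-n(C_n) for every n.  Testing it with A = C_n and with A = ~` C_n forces
   mu(D) = 0 unless mu(E) is 0 or 1, so the tail sigma-algebra is trivial.
   Conversely let h_n in [0, 1] be a version of P^n \1_B.  The functions
   f_n = h_n o phi^n are the conditional expectations of \1_B given
   phi^-n(Sigma); since int f_n f_m = int f_m^2 for n <= m they form a Cauchy
   sequence in L^2, hence in L^1.  Along a fast subsequence, the sets where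
   f_n > t infinitely often are tail events, so the limit is constant and equal
   to mu(B); thus P^n \1_B --> mu(B) in L^1.  Exactness of a general f then
   follows by density of simple functions, because || P^n f - int f ||_1 is, up
   to a factor 2, the supremum over A of
   | int_(phi^-n A) f - mu(A) int f |. *)

(** * Integrable real functions on a probability space *)

Definition Rintegrable {d} {T : measurableType d} {R : realType}
  (mu : set T -> \bar R) (f : T -> R) := mu.-integrable setT (EFin \o f).

Section real_integral.
Import HBSimple.
Set Implicit Arguments.
Unset Strict Implicit.
Context {R : realType} {d : measure_display} {T : measurableType d}.
Variable mu : probability T R.
Implicit Types (f g : T -> R) (A : set T).

Lemma Rintegrable_measurable f : Rintegrable mu f -> measurable_fun setT f.
Proof. by move=> /(measurable_int mu) /measurable_EFinP. Qed.

Lemma RintegrableD f g : Rintegrable mu f -> Rintegrable mu g ->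
  Rintegrable mu (fun x => f x + g x).
Proof. by move=> fi gi; exact: (integrableD measurableT fi gi). Qed.

Lemma RintegrableZ k f : Rintegrable mu f -> Rintegrable mu (fun x => k * f x).
Proof. by move=> fi; exact: (integrableZl measurableT k fi). Qed.

Lemma RintegrableB f g : Rintegrable mu f -> Rintegrable mu g ->
  Rintegrable mu (fun x => f x - g x).
Proof. by move=> fi gi; exact: (integrableB measurableT fi gi). Qed.

Lemma Rintegrable_norm f : Rintegrable mu f ->
  Rintegrable mu (fun x => `|f x|).
Proof. by move=> fi; exact: (integrable_norm fi). Qed.

Lemma Rintegrable_cst k : Rintegrable mu (fun=> k).
Proof. exact: finite_measure_integrable_cst. Qed.

Lemma Rintegrable_indic A : measurable A -> Rintegrable mu (\1_A : T -> R).
Proof. by move=> mA; exact: integrable_indic. Qed.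

Lemma RintegrableM f g k : Rintegrable mu f -> measurable_fun setT g ->
  (forall x, `|g x| <= k) -> Rintegrable mu (fun x => f x * g x).
Proof.
move=> fi mg gk; apply: (integrableMl measurableT fi mg).
exists k; split; first by rewrite num_real.
by move=> M kM x _; exact: le_trans (gk x) (ltW kM).
Qed.

Lemma Rintegrable_bounded g k : measurable_fun setT g ->
  (forall x, `|g x| <= k) -> Rintegrable mu g.
Proof.
move=> mg gk; have := RintegrableM (Rintegrable_cst 1) mg gk.
by congr (Rintegrable _ _); apply/funext => x; rewrite mul1r.
Qed.

Lemma norm_indic_le1 A x : `|\1_A x : R| <= 1.
Proof. by rewrite indicE ger0_norm ?lern1 ?leq_b1. Qed.

Lemma RintegrableM_indic f A : Rintegrable mu f -> measurable A ->
  Rintegrable mu (fun x => f x * \1_A x).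
Proof.
move=> fi mA; apply: (@RintegrableM _ _ 1) => //.
exact: norm_indic_le1.
Qed.

Lemma Rintegral_le f g : Rintegrable mu f -> Rintegrable mu g ->
  (forall x, f x <= g x) -> \int[mu]_x f x <= \int[mu]_x g x.
Proof. by move=> fi gi fg; exact: le_Rintegral. Qed.

Lemma Rintegral_indic A : measurable A -> \int[mu]_x \1_A x = fine (mu A).
Proof. by move=> mA; rewrite /Rintegral integral_indic// setIT. Qed.

Lemma Rintegral_const k : \int[mu]_x k = k.
Proof. by rewrite Rintegral_cst// [X in fine X](@probability_setT _ _ _ mu) mulr1. Qed.

Lemma Rintegral_setE f A : \int[mu]_(x in A) f x = \int[mu]_x (f x * \1_A x).
Proof.
rewrite Rintegral_mkcond; apply: eq_Rintegral => x _.
by rewrite patchE indicE; case: (x \in A); rewrite ?mulr1 ?mulr0.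
Qed.

Lemma EFin_Rintegral f : Rintegrable mu f ->
  (\int[mu]_x f x)%:E = (\int[mu]_x (f x)%:E)%E.
Proof.
by move=> fi; rewrite /Rintegral fineK//; exact: (integrable_fin_num _ fi).
Qed.

(** Simple functions are finite combinations of indicators of their level sets and are dense in
    $L^1$. This induction principle carries both the mixing property and the duality formula from
    indicators to integrable functions. *)
Lemma Rintegrable_ind (Q : (T -> R) -> Prop) :
  (forall A, measurable A -> Q \1_A) ->
  (forall k f g, Rintegrable mu f -> Rintegrable mu g -> Q f -> Q g ->
     Q (fun x => k * f x + g x)) ->
  (forall f, Rintegrable mu f ->
     (forall e, 0 < e -> exists g,
        [/\ Rintegrable mu g, Q g & \int[mu]_x `|f x - g x| <= e]) -> Q f) ->
  forall f, Rintegrable mu f -> Q f.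
Proof.
move=> Qi Ql Qc f fi.
have Qs (g : {sfun T >-> R}) : Rintegrable mu (fun x => g x) /\ Q (fun x => g x).
  have -> : (fun x => g x) =
      fun x => \sum_(y <- finmap.enum_fset (fset_set (range g)))
        y * \1_(g @^-1` [set y]) x.
    by apply/funext => x; rewrite {1}fimfunE fsbig_finite.
  elim: (finmap.enum_fset _) => [|y s [IHi IHQ]].
    (* The empty sum is the indicator of the empty set, so the indicator case already covers it. *)
    have -> : (fun x : T => \sum_(y <- [::]) y * \1_(g @^-1` [set y]) x : R) = \1_set0.
      by apply/funext => x; rewrite big_nil indicE in_set0.
    by split; [exact: Rintegrable_indic | exact: Qi].
  have mg : measurable (g @^-1` [set y]) by exact: measurable_sfunP.
  have -> : (fun x : T => \sum_(j <- y :: s) j * \1_(g @^-1` [set j]) x) =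
     (fun x => y * \1_(g @^-1` [set y]) x + \sum_(j <- s) j * \1_(g @^-1` [set j]) x).
    by apply/funext => x; rewrite big_cons.
  have gi : Rintegrable mu (\1_(g @^-1` [set y]) : T -> R) by exact: Rintegrable_indic.
  split; last by apply: Ql => //; exact: Qi.
  by apply: RintegrableD => //; exact: RintegrableZ.
apply: Qc => // e e0.
have [g_ [gi _ cvg]] := approximation_sfun_integrable measurableT fi.
have /fine_cvgP[_ /cvgrPdist_le/(_ e e0)[N _ /(_ N (leqnn _))]] := cvg.
rewrite sub0r normrN => gN; exists (fun x => g_ N x).
split; [exact: (Qs _).1|exact: (Qs _).2|].
exact: le_trans (ler_norm _) gN.
Qed.

End real_integral.

(** * Invariance of integrals and the Perron-Frobenius duality *)

Section measure_preserving_map.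
Set Implicit Arguments.
Unset Strict Implicit.
Context {R : realType} {d : measure_display} {T : measurableType d}.
Variable mu : probability T R.
Implicit Types (f g : T -> R) (A : set T) (psi : T -> T).

Lemma measurable_preimage psi A : measurable_fun setT psi -> measurable A ->
  measurable (psi @^-1` A).
Proof. by move=> mpsi mA; rewrite -[X in measurable X]setTI; apply: mpsi. Qed.

Lemma measure_preserving_iter psi n :
  measure_preserving mu psi -> measure_preserving mu (iter n psi).
Proof.
move=> [mpsi ppsi]; elim: n => [|n [mn pn]].
  by split=> [|A mA]; [exact: measurable_id|].
split=> [|A mA]; first exact: (measurableT_comp mpsi mn).
rewrite (_ : _ @^-1` A = iter n psi @^-1` (psi @^-1` A))// pn ?ppsi//.
exact: measurable_preimage.
Qed.

Lemma ge0_integral_comp psi (f : T -> \bar R) : measure_preserving mu psi ->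
  measurable_fun setT f -> (forall x, 0 <= f x)%E ->
  (\int[mu]_x f (psi x) = \int[mu]_x f x)%E.
Proof.
move=> [mpsi ppsi] mf f0.
rewrite -[LHS](ge0_integral_pushforward mpsi mu measurableT mf)//.
(* Bundling [psi] as a measurable function lets the pushforward be recognised as a measure, to be
   compared with [mu] on measurable sets. *)
pose mpsi_mixin := isMeasurableFun.Build _ _ _ _ _ mpsi.
pose mpsi_pack : {mfun _ >-> _} := HB.pack psi mpsi_mixin.
rewrite -/(pushforward mu mpsi_pack).
by apply: eq_measure_integral => A mA _; exact: ppsi.
Qed.

Lemma Rintegrable_comp psi f : measure_preserving mu psi -> Rintegrable mu f ->
  Rintegrable mu (fun x => f (psi x)).
Proof.
move=> ppsi /integrableP[mf foo]; apply/integrableP; split.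
  exact: (measurableT_comp mf ppsi.1).
rewrite (@ge0_integral_comp psi (fun x => `|(EFin \o f) x|%E))//.
exact: measurableT_comp.
Qed.

Lemma Rintegral_comp psi f : measure_preserving mu psi -> Rintegrable mu f ->
  \int[mu]_x f (psi x) = \int[mu]_x f x.
Proof.
move=> pp; have [mpsi ppsi] := pp => fi; congr fine.
have fpi := Rintegrable_comp pp fi.
pose mpsi_mixin := isMeasurableFun.Build _ _ _ _ _ mpsi.
pose mpsi_pack : {mfun _ >-> _} := HB.pack psi mpsi_mixin.
have mf : measurable_fun setT (EFin \o f) by case/integrableP : fi.
have := integral_pushforward mpsi mf fpi measurableT.
rewrite preimage_setT => <-.
rewrite -/(pushforward mu mpsi_pack).
by apply: eq_measure_integral => A mA _; exact: ppsi.
Qed.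

(** Split the space by the sign of [g]: the norm is the integral over the set where [g] is
    nonnegative minus the one over its complement, and each piece costs at most [e]. *)
Lemma Rintegral_norm_le2 g e : Rintegrable mu g ->
  (forall A, measurable A -> `|\int[mu]_x (g x * \1_A x)| <= e) ->
  \int[mu]_x `|g x| <= e + e.
Proof.
move=> gi ge; pose A := [set x | 0 <= g x].
have mA : measurable A.
  have := Rintegrable_measurable gi measurableT (measurable_itv `[0, +oo[).
  by rewrite setTI; congr measurable; apply/seteqP; split=> x;
    rewrite /= in_itv/= andbT.
have mAC : measurable (~` A) by exact: measurableC.
have -> : \int[mu]_x `|g x| =
    \int[mu]_x (g x * \1_A x) - \int[mu]_x (g x * \1_(~` A) x).
  rewrite -RintegralB//; [|exact: RintegrableM_indic..].
  apply: eq_Rintegral => x _; rewrite !indicE in_setC.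
  have [xA|xA] := boolP (x \in A).
    by rewrite mulr1 mulr0 subr0 ger0_norm//; exact: (set_mem xA).
  rewrite mulr1 mulr0 sub0r ler0_norm//.
  by move: xA; rewrite notin_setE /A /= => /negP; rewrite -ltNge => /ltW.
apply: lerD.
  exact: le_trans (ler_norm _) (ge _ mA).
by apply: le_trans (ge _ mAC); rewrite -normrN; exact: ler_norm.
Qed.

Section perron_frobenius.
Variables (psi : T -> T) (P : (T -> R) -> (T -> R)).
Hypotheses (ppsi : measure_preserving mu psi)
  (PF : is_perron_frobenius mu psi P).

Lemma Rintegral_perron_frobenius f A : Rintegrable mu f -> measurable A ->
  \int[mu]_x (P f x * \1_A x) = \int[mu]_x (f x * \1_A (psi x)).
Proof.
move=> /PF[_ +] mA => /(_ _ mA)/(congr1 fine) e.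
by rewrite -Rintegral_setE [LHS]e -/(Rintegral mu _ f) Rintegral_setE.
Qed.

Lemma Rintegrable_perron_frobenius f : Rintegrable mu f -> Rintegrable mu (P f).
Proof. by case/PF. Qed.

(** Duality moves [\1_A] across [P]. The right-hand side is the correlation of [f] with [A], so this
    identity links $L^1$ convergence of iterates to mixing. *)
Lemma Rintegral_centered f A : Rintegrable mu f -> measurable A ->
  \int[mu]_x ((P f x - \int[mu]_y f y) * \1_A x) =
  \int[mu]_x (f x * \1_A (psi x)) - fine (mu A) * \int[mu]_x f x.
Proof.
move=> fi mA; rewrite -Rintegral_perron_frobenius// mulrC.
rewrite -[in RHS]Rintegral_indic// -RintegralZl//; last exact: Rintegrable_indic.
rewrite -RintegralB//.
- by apply: eq_Rintegral => x _; rewrite mulrBl.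
- by apply: RintegrableM_indic => //; exact: Rintegrable_perron_frobenius.
- by apply: RintegrableZ; exact: Rintegrable_indic.
Qed.

Lemma correlation_le f A : Rintegrable mu f -> measurable A ->
  `|\int[mu]_x (f x * \1_A (psi x)) - fine (mu A) * \int[mu]_x f x| <=
  \int[mu]_x `|P f x - \int[mu]_y f y|.
Proof.
move=> fi mA; rewrite -Rintegral_centered//.
have gi : Rintegrable mu (fun x => P f x - \int[mu]_y f y).
  by apply: RintegrableB; [exact: Rintegrable_perron_frobenius|exact: Rintegrable_cst].
have gAi := RintegrableM_indic gi mA.
apply: le_trans (le_normr_Rintegral measurableT gAi) _.
apply: Rintegral_le => [||x]; [exact: Rintegrable_norm..|].
by rewrite normrM ler_piMr// norm_indic_le1.
Qed.

Lemma le_correlation f e : Rintegrable mu f ->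
  (forall A, measurable A ->
   `|\int[mu]_x (f x * \1_A (psi x)) - fine (mu A) * \int[mu]_x f x| <= e) ->
  \int[mu]_x `|P f x - \int[mu]_y f y| <= e + e.
Proof.
move=> fi fe; apply: Rintegral_norm_le2 => [|A mA].
  by apply: RintegrableB; [exact: Rintegrable_perron_frobenius|exact: Rintegrable_cst].
by rewrite Rintegral_centered//; exact: fe.
Qed.

End perron_frobenius.

(** Pull [A] back first by [psi] and then by [iter n psi]. Estimates for one map and its operator
    thus apply to all iterates. *)
Lemma is_perron_frobenius_iter psi P n : measure_preserving mu psi ->
  is_perron_frobenius mu psi P ->
  is_perron_frobenius mu (iter n psi) (iter n P).
Proof.
move=> pp PF; elim: n => [|n IH] f fi; first by split.
have [gi gE] := IH f fi; have [ki kE] := PF _ gi.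
split=> // A mA; rewrite [LHS]kE// gE//.
exact: measurable_preimage pp.1 mA.
Qed.

End measure_preserving_map.

(** * Correlations, uniform mixing and tail events *)

(** For [f] equal to [\1_B] this is $\mu(\psi^{-1}(A)\cap B)-\mu(A)\mu(B)$. Allowing integrable [f]
    makes it linear in [f], which the density argument needs. *)
Definition correlation {d} {T : measurableType d} {R : realType}
  (mu : {measure set T -> \bar R}) (psi : T -> T) (f : T -> R) (A : set T) : R :=
  \int[mu]_x (f x * \1_A (psi x)) - fine (mu A) * \int[mu]_x f x.

(** Choosing [N] before [A] encodes the supremum over [S]. The family [S] is all measurable sets for
    (ii) and the traces on [D] for (iii). *)
Definition uniformly_mixing {d} {T : measurableType d} {R : realType}
  (mu : {measure set T -> \bar R}) (phi : T -> T) (S : set (set T))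
  (f : T -> R) : Prop :=
  forall e, 0 < e -> exists N, forall n A, (N <= n)%N -> S A ->
    `|correlation mu (iter n phi) f A| <= e.

(** These are the members of $\bigcap_n \phi^{-n}(\Sigma)$, with equality of sets rather than
    equality up to null sets. The case of [n] zero gives measurability of [E]. *)
Definition tail_event {d} {T : measurableType d} (phi : T -> T) (E : set T) :=
  forall n, exists2 C, measurable C & E = iter n phi @^-1` C.

Section mixing.
Set Implicit Arguments.
Unset Strict Implicit.
Context {R : realType} {d : measure_display} {T : measurableType d}.
Variables (mu : probability T R) (phi : T -> T).
Hypothesis pphi : measure_preserving mu phi.
Implicit Types (f g : T -> R) (A B : set T).

Lemma RintegrableM_indic_comp psi f A : measure_preserving mu psi ->
  Rintegrable mu f -> measurable A ->
  Rintegrable mu (fun x => f x * \1_A (psi x)).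
Proof.
move=> ppsi fi mA; apply: (@RintegrableM _ _ _ _ _ _ 1) => //.
  apply: (@measurableT_comp _ _ _ _ _ _ (\1_A : T -> R)) => //.
  exact: ppsi.1.
by move=> x; exact: norm_indic_le1.
Qed.

Lemma correlationD psi k f g A : measure_preserving mu psi ->
  Rintegrable mu f -> Rintegrable mu g -> measurable A ->
  correlation mu psi (fun x => k * f x + g x) A =
  k * correlation mu psi f A + correlation mu psi g A.
Proof.
move=> ppsi fi gi mA; rewrite /correlation.
have kfi := RintegrableZ k fi.
rewrite (RintegralD measurableT kfi gi) (RintegralZl k measurableT fi).
have fAi := RintegrableM_indic_comp ppsi fi mA.
have gAi := RintegrableM_indic_comp ppsi gi mA.
have -> : \int[mu]_x ((k * f x + g x) * \1_A (psi x)) =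
    k * \int[mu]_x (f x * \1_A (psi x)) + \int[mu]_x (g x * \1_A (psi x)).
  rewrite -(RintegralZl k measurableT fAi) -RintegralD//; last first.
    exact: (RintegrableZ k fAi).
  by apply: eq_Rintegral => x _; rewrite mulrDl mulrA.
ring.
Qed.

Lemma fine_probability_le1 A : measurable A -> 0 <= fine (mu A) <= 1.
Proof.
move=> mA; rewrite fine_ge0//= -lee_fin fineK ?fin_num_measure//.
exact: probability_le1.
Qed.

(** Both terms of the correlation are bounded by the $L^1$ norm of [f]. The bound is uniform in [A]
    and [psi], so mixing survives $L^1$ limits. *)
Lemma correlation_le_norm psi f A : measure_preserving mu psi ->
  Rintegrable mu f -> measurable A ->
  `|correlation mu psi f A| <= \int[mu]_x `|f x| *+ 2.
Proof.
move=> ppsi fi mA; rewrite /correlation mulr2n.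
have fAi := RintegrableM_indic_comp ppsi fi mA.
apply: le_trans (ler_normB _ _) _; apply: lerD.
  apply: le_trans (le_normr_Rintegral measurableT fAi) _.
  apply: Rintegral_le => [||x]; [exact: Rintegrable_norm..|].
  by rewrite normrM ler_piMr// norm_indic_le1.
have /andP[A0 A1] := fine_probability_le1 mA.
rewrite normrM (ger0_norm A0); apply: le_trans (ler_piMl _ A1) _ => //.
exact: le_normr_Rintegral.
Qed.

Lemma uniformly_mixing_integrable :
  (forall B, measurable B -> uniformly_mixing mu phi measurable \1_B) ->
  forall f, Rintegrable mu f -> uniformly_mixing mu phi measurable f.
Proof.
move=> mixB; apply: Rintegrable_ind => // [k f g fi gi mf mg|f fi fa] e e0.
  (* Adding 1 keeps the divisor positive when [k] is zero; multiplying by [|k|] then leaves at most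
     [e / 2]. *)
  have e20 : 0 < e / 2 / (`|k| + 1) by rewrite !divr_gt0// ltr_wpDl.
  have [N1 N1P] := mf _ e20.
  have [N2 N2P] := mg _ (divr_gt0 e0 (ltr0n _ 2)).
  exists (maxn N1 N2) => n A; rewrite geq_max => /andP[n1 n2] mA.
  rewrite correlationD//; last exact: measure_preserving_iter.
  apply: le_trans (ler_normD _ _) _; rewrite [leRHS]splitr; apply: lerD.
    rewrite normrM.
    have /(ler_wpM2l (normr_ge0 k))/le_trans := N1P _ _ n1 mA; apply.
    rewrite mulrA ler_pdivrMr ?ltr_wpDl// mulrDr mulr1 mulrC lerDl.
    by rewrite divr_ge0// ltW.
  exact: N2P.
(* An $L^1$ error of [e / 4] changes correlations by at most [e / 2], because of the factor 2 in
   [correlation_le_norm]. *)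
have [g [gi mg fg]] := fa _ (divr_gt0 e0 (ltr0n _ 4)).
have [N NP] := mg _ (divr_gt0 e0 (ltr0n _ 2)).
exists N => n A Nn mA; have pn := measure_preserving_iter n pphi.
have fgi := RintegrableB fi gi.
have -> : f = (fun x => 1 * g x + (f x - g x)).
  by apply/funext => x; rewrite mul1r addrC subrK.
rewrite correlationD// mul1r; apply: le_trans (ler_normD _ _) _.
apply: le_trans (lerD (NP _ _ Nn mA) (correlation_le_norm pn fgi mA)) _.
by move: fg; lra.
Qed.

(** For the [n]-th iterates, [correlation_le] bounds every correlation by the $L^1$ distance, and
    [le_correlation] bounds that distance by twice a uniform bound on the correlations. *)
Lemma exact_uniformly_mixing P f : is_perron_frobenius mu phi P ->
  Rintegrable mu f ->
  (fun n => \int[mu]_x (`|iter n P f x - fine (\int[mu]_y (f y)%:E)|)%:E)%E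
    @ \oo --> 0%E <->
  uniformly_mixing mu phi measurable f.
Proof.
move=> PF fi; have pn n := measure_preserving_iter n pphi.
have PFn n := is_perron_frobenius_iter n pphi PF.
have gi n : Rintegrable mu (fun x => `|iter n P f x - \int[mu]_y f y|).
  apply: Rintegrable_norm; apply: RintegrableB; last exact: Rintegrable_cst.
  by have [] := PFn n f fi.
split=> [/fine_cvgP[_ /cvgrPdist_le cvg] e e0|mix].
  have [N _ NP] := cvg e e0; exists N => n A Nn mA.
  apply: le_trans (correlation_le (PFn n) fi mA) _.
  have := NP n Nn; rewrite sub0r normrN; apply: le_trans.
  exact: ler_norm.
apply/fine_cvgP; split.
  by apply: nearW => n; exact: (integrable_fin_num measurableT (gi n)).
apply/cvgrPdist_le => e e0; have [N NP] := mix _ (divr_gt0 e0 (ltr0n _ 2)).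
exists N => // n /= Nn; rewrite sub0r normrN ger0_norm; last first.
  by apply: fine_ge0; exact: integral_ge0.
rewrite [leRHS]splitr; apply: (le_correlation (PFn n) fi) => A mA.
exact: NP.
Qed.

Lemma correlation_indic n A B : measurable A -> measurable B ->
  (`|correlation mu (iter n phi) \1_B A|%:E =
   `|mu (iter n phi @^-1` A `&` B) - mu A * mu B|)%E.
Proof.
move=> mA mB; have mnA := measurable_preimage (measure_preserving_iter n pphi).1 mA.
rewrite -[X in (X - _)%E](@fineK R) ?fin_num_measure//; last exact: measurableI.
rewrite -[X in (_ - X * _)%E](@fineK R) ?fin_num_measure//.
rewrite -[X in (_ - _ * X)%E](@fineK R) ?fin_num_measure//.
rewrite -EFinM -EFinB /=; congr (`|_ - _ * _|%:E).
  rewrite -Rintegral_indic; last exact: measurableI.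
  by apply: eq_Rintegral => x _; rewrite indicI mulrC.
exact: Rintegral_indic.
Qed.

(** The membership of [set0] in [S] prevents the supremum from being $-\infty$, and
    [correlation_le_norm] keeps it below $+\infty$, so convergence can be tested on real values. *)
Lemma mixing_uniformly_mixing (S : set (set T)) B : S set0 -> S `<=` measurable ->
  measurable B ->
  (fun n => ereal_sup [set `|mu (iter n phi @^-1` A `&` B) - mu A * mu B|%E
     | A in S]) @ \oo --> 0%E <->
  uniformly_mixing mu phi S \1_B.
Proof.
move=> S0 Sm mB; pose s n := ereal_sup
  [set `|mu (iter n phi @^-1` A `&` B) - mu A * mu B|%E | A in S].
have sle n A : S A -> (`|correlation mu (iter n phi) \1_B A|%:E <= s n)%E.
  by move=> SA; apply: ereal_sup_ubound; exists A => //;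
    rewrite correlation_indic//; exact: Sm.
have les n e : (forall A, S A -> `|correlation mu (iter n phi) \1_B A| <= e) ->
    (s n <= e%:E)%E.
  move=> Ae; apply: ge_ereal_sup => _ [A SA <-].
  by rewrite -correlation_indic ?lee_fin; [exact: Ae|exact: Sm|].
have s0 n : (0 <= s n)%E by apply: le_trans (sle n _ S0).
have sfin n : s n \is a fin_num.
  rewrite ge0_fin_numE//.
  apply: (@le_lt_trans _ _ (\int[mu]_x `|\1_B x : R| *+ 2)%:E); last exact: ltry.
  apply: les => A SA; apply: correlation_le_norm; last exact: Sm.
    exact: measure_preserving_iter.
  exact: Rintegrable_indic.
split=> [/fine_cvgP[_ /cvgrPdist_le cvg] e e0|mix].
  have [N _ NP] := cvg e e0; exists N => n A Nn SA.
  have := NP n Nn; rewrite sub0r normrN; apply: le_trans.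
  apply: le_trans (ler_norm _); rewrite -lee_fin fineK; first exact: sle.
  exact: sfin.
apply/fine_cvgP; split; first by apply: nearW => n; exact: sfin.
apply/cvgrPdist_le => e e0; have [N NP] := mix _ e0.
exists N => // n /= Nn; rewrite sub0r normrN ger0_norm; last first.
  by apply: fine_ge0; exact: s0.
rewrite -lee_fin fineK; last exact: sfin.
by apply: les => A SA; exact: NP.
Qed.

(* If E = phi^-n(C), the correlations of E with C and with ~` C are
   mu(C) (1 - mu(E)) and - mu(~` C) mu(E), localized to D. *)
Lemma tail_event_trivial E : tail_event phi E ->
  (exists D, [/\ measurable D, (0 < mu D)%E &
    uniformly_mixing mu phi [set A `&` D | A in measurable] \1_E]) ->
  fine (mu E) = 0 \/ fine (mu E) = 1.
Proof.
move=> tE [D [mD D0 mixE]].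
have mE : measurable E by have [C mC ->] := tE 0%N; exact: mC.
set b := fine (mu E); have /andP[b0 b1] : 0 <= b <= 1.
  exact: fine_probability_le1.
have [->|bn0] := eqVneq b 0; first by left.
have [->|bn1] := eqVneq b 1; first by right.
have {}b0 : 0 < b by rewrite lt_neqAle eq_sym bn0.
have {}b1 : b < 1 by rewrite lt_neqAle bn1.
have mu0 : 0 < fine (mu D).
  by rewrite fine_gt0// D0 -ge0_fin_numE// fin_num_measure.
(* With this tolerance $\mu(C\cap D)\le\mu(D)b/2$ and $\mu(C^c\cap D)\le\mu(D)(1-b)/2$. Adding them
   gives $\mu(D)\le\mu(D)/2$, a contradiction. *)
have e0 : 0 < fine (mu D) * b * (1 - b) / 2.
  by rewrite divr_gt0// !mulr_gt0// subr_gt0.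
have [N /(_ N _ (leqnn _)) NP] := mixE _ e0.
have [C mC EC] := tE N.
have mCC : measurable (~` C) by exact: measurableC.
have iE : \int[mu]_x \1_E x = b by exact: Rintegral_indic.
have pN := measure_preserving_iter N pphi.
have cE A : measurable A ->
    correlation mu (iter N phi) \1_E (A `&` D) =
    \int[mu]_x (\1_C x * \1_(A `&` D) x) - fine (mu (A `&` D)) * b.
  move=> mA; have mAD := measurableI _ _ mA mD.
  have CADi := RintegrableM_indic (Rintegrable_indic mu mC) mAD.
  by rewrite /correlation iE -(Rintegral_comp pN CADi) EC.
have cC : correlation mu (iter N phi) \1_E (C `&` D) =
    fine (mu (C `&` D)) * (1 - b).
  rewrite cE// mulrBr mulr1; congr (_ - _).
  rewrite -Rintegral_indic; last exact: measurableI.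
  apply: eq_Rintegral => x _; rewrite !indicE in_setI.
  by case: (x \in C); rewrite ?mul1r ?mul0r.
have cCC : correlation mu (iter N phi) \1_E (~` C `&` D) =
    - (fine (mu (~` C `&` D)) * b).
  rewrite cE// -[RHS]sub0r; congr (_ - _).
  rewrite -[RHS](Rintegral_const mu 0).
  apply: eq_Rintegral => x _; rewrite !indicE in_setI in_setC.
  by case: (x \in C); rewrite ?mul1r ?mul0r.
have [/andP[p0 _] /andP[q0 _]] := (fine_probability_le1 (measurableI _ _ mC mD),
  fine_probability_le1 (measurableI _ _ mCC mD)).
have muD : fine (mu D) = fine (mu (C `&` D)) + fine (mu (~` C `&` D)).
  rewrite -!Rintegral_indic//; [|exact: measurableI..].
  rewrite -RintegralD//; [|exact: Rintegrable_indic (measurableI _ _ _ _)..].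
  apply: eq_Rintegral => x _; rewrite !indicE !in_setI in_setC.
  by case: (x \in C); rewrite /= ?addr0 ?add0r.
have := NP _ (ex_intro2 _ _ C mC erefl); rewrite cC.
have := NP _ (ex_intro2 _ _ _ mCC erefl); rewrite cCC normrN.
rewrite !ger0_norm ?mulr_ge0 ?subr_ge0 ?(ltW b0) ?(ltW b1)//.
set p := fine _ in p0 muD *; set q := fine _ in q0 muD *.
move=> qb pb.
have : q <= fine (mu D) * (1 - b) / 2.
  rewrite -(ler_pM2r b0); apply: le_trans qb _.
  by rewrite le_eqVlt; apply/orP; left; apply/eqP; field.
have : p <= fine (mu D) * b / 2.
  rewrite -(@ler_pM2r _ (1 - b)) ?subr_gt0//; apply: le_trans pb _.
  by rewrite le_eqVlt; apply/orP; left; apply/eqP; field.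
lra.
Qed.

End mixing.

(** * Transferred indicators with values in the unit interval *)

Section density.
Set Implicit Arguments.
Unset Strict Implicit.
Context {R : realType} {d : measure_display} {T : measurableType d}.
Variables (mu : probability T R).
Implicit Types (f g h : T -> R) (A B : set T).

(** [P \1_B] lies in $[0,1]$ only almost everywhere, so it is truncated; the truncation changes it
    on a null set and leaves its integrals unchanged. *)
Lemma perron_frobenius_density psi P B : measure_preserving mu psi ->
  is_perron_frobenius mu psi P -> measurable B ->
  exists h, [/\ measurable_fun setT h, forall x, 0 <= h x <= 1 &
    forall A, measurable A ->
      \int[mu]_x (h x * \1_A x) = \int[mu]_x (\1_B x * \1_A (psi x))].
Proof.
move=> ppsi PF mB; pose k := P \1_B.
have Bi : Rintegrable mu (\1_B : T -> R) by exact: Rintegrable_indic.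
have ki : Rintegrable mu k by exact: (Rintegrable_perron_frobenius PF).
have mk := Rintegrable_measurable ki.
pose h x := Num.max 0 (Num.min (k x) 1).
have mh : measurable_fun setT h.
  by apply: measurable_maxr => //; exact: measurable_minr.
have h01 x : 0 <= h x <= 1.
  by rewrite /h le_max lexx ge_max ler01 ge_min lexx orbT.
have hi : Rintegrable mu h.
  apply: (@Rintegrable_bounded _ _ _ _ _ 1) => // x.
  by have /andP[? ?] := h01 x; rewrite ger0_norm.
pose A := [set x | k x < 0]; pose C := [set x | 1 < k x].
have mA : measurable A.
  have := mk measurableT _ (measurable_itv `]-oo, 0[).
  by rewrite setTI; congr measurable; apply/seteqP; split=> x; rewrite /= in_itv.
have mC : measurable C.
  have := mk measurableT _ (measurable_itv `]1, +oo[).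
  by rewrite setTI; congr measurable; apply/seteqP; split=> x;
    rewrite /= in_itv/= andbT.
have kAi := RintegrableM_indic ki mA.
have kCi := RintegrableM_indic ki mC.
have Ci := Rintegrable_indic mu mC.
have khi := Rintegrable_norm (RintegrableB ki hi).
(* The distance is $\int_C (k-1)-\int_A k$. By duality $\int_C k=\mu(B\cap\psi^{-1}(C))\le\mu(C)$
   and $\int_A k=\mu(B\cap\psi^{-1}(A))\ge 0$. *)
have kh : \int[mu]_x `|k x - h x| <= 0.
  have -> : \int[mu]_x `|k x - h x| =
      \int[mu]_x (k x * \1_C x) - \int[mu]_x \1_C x - \int[mu]_x (k x * \1_A x).
    rewrite -RintegralB// -RintegralB//; last exact: RintegrableB.
    apply: eq_Rintegral => x _; rewrite !indicE.
    have -> : (x \in A) = (k x < 0) by apply/idP/idP; rewrite inE.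
    have -> : (x \in C) = (1 < k x) by apply/idP/idP; rewrite inE.
    rewrite /h; have [kx0|kx0] := ltP (k x) 0.
      have k1 : k x <= 1 by lra.
      rewrite (min_idPl k1) (max_idPl (ltW kx0)) ltNge k1/= subr0 ltr0_norm//.
      by rewrite !(mulr0, mulr1) !sub0r oppr0 sub0r.
    have [kx1|kx1] := ltP 1 (k x).
      rewrite (max_idPr ler01) mulr1 mulr0 subr0 gtr0_norm ?subr_gt0//.
    by rewrite (max_idPr kx0) !mulr0 !subr0 subrr normr0.
  rewrite !(Rintegral_perron_frobenius PF)//.
  have -> : \int[mu]_x \1_C x = \int[mu]_x (\1_C (psi x) : R).
    by rewrite (Rintegral_comp ppsi Ci).
  have A0 : 0 <= \int[mu]_x (\1_B x * \1_A (psi x) : R).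
    by apply: Rintegral_ge0 => x _; rewrite mulr_ge0// indicE.
  have : \int[mu]_x (\1_B x * \1_C (psi x)) <= \int[mu]_x (\1_C (psi x) : R).
    apply: Rintegral_le; [exact: RintegrableM_indic_comp| |].
      exact: (Rintegrable_comp ppsi Ci).
    by move=> x; rewrite !indicE; case: (_ \in B); rewrite ?mul1r ?mul0r.
  by lra.
exists h; split=> // D mD.
rewrite -(Rintegral_perron_frobenius PF Bi mD) -/k.
have kDi := RintegrableM_indic ki mD; have hDi := RintegrableM_indic hi mD.
have kDh := RintegrableB kDi hDi.
apply/esym/eqP; rewrite -subr_eq0 -RintegralB// -normr_le0.
apply: le_trans kh; apply: le_trans (le_normr_Rintegral measurableT kDh) _.
apply: Rintegral_le => //; first exact: Rintegrable_norm.
by move=> x; rewrite -mulrBl normrM ler_piMr// norm_indic_le1.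
Qed.

(** The hypothesis is the case of indicators [u]. Both sides are linear in [u] and, since [h] is
    bounded by 1 and [psi] preserves [mu], $L^1$-continuous, so [Rintegrable_ind] applies. *)
Lemma density_duality psi h B u : measure_preserving mu psi -> measurable B ->
  measurable_fun setT h -> (forall x, 0 <= h x <= 1) ->
  (forall A, measurable A ->
    \int[mu]_x (h x * \1_A x) = \int[mu]_x (\1_B x * \1_A (psi x))) ->
  Rintegrable mu u ->
  \int[mu]_x (u x * h x) = \int[mu]_x (u (psi x) * \1_B x).
Proof.
move=> ppsi mB mh h01 hE.
have h1 x : `|h x| <= 1 by have /andP[? ?] := h01 x; rewrite ger0_norm.
have uhi f : Rintegrable mu f -> Rintegrable mu (fun x => f x * h x).
  by move=> fi; exact: (RintegrableM fi mh h1).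
have uBi f : Rintegrable mu f -> Rintegrable mu (fun x => f (psi x) * \1_B x).
  by move=> fi; apply: RintegrableM_indic => //; exact: Rintegrable_comp.
move: u; apply: Rintegrable_ind => [A mA|k f g fi gi fE gE|f fi fa].
- transitivity (\int[mu]_x (h x * \1_A x)).
    by apply: eq_Rintegral => x _; rewrite mulrC.
  by rewrite hE//; apply: eq_Rintegral => x _; rewrite mulrC.
- transitivity (k * \int[mu]_x (f x * h x) + \int[mu]_x (g x * h x)).
    rewrite -(RintegralZl k measurableT (uhi _ fi)) -RintegralD//.
    + by apply: eq_Rintegral => x _; rewrite mulrDl mulrA.
    + exact: RintegrableZ (uhi _ fi).
    + exact: uhi.
  rewrite fE gE -(RintegralZl k measurableT (uBi _ fi)) -RintegralD//.
  + by apply: eq_Rintegral => x _; rewrite mulrDl mulrA.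
  + exact: RintegrableZ (uBi _ fi).
  + exact: uBi.
- apply/eqP; rewrite -subr_eq0 -normr_le0; apply/ler_addgt0Pr => e e0; rewrite add0r.
  have [g [gi gE fg]] := fa _ (divr_gt0 e0 (ltr0n _ 2)).
  have fgi := RintegrableB fi gi; have nfgi := Rintegrable_norm fgi.
  have -> : \int[mu]_x (f x * h x) =
      \int[mu]_x (g x * h x) + \int[mu]_x ((f x - g x) * h x).
    rewrite -RintegralD//; [|exact: uhi|exact: (uhi _ fgi)].
    by apply: eq_Rintegral => x _; rewrite -mulrDl addrC subrK.
  have -> : \int[mu]_x (f (psi x) * \1_B x) =
      \int[mu]_x (g (psi x) * \1_B x) + \int[mu]_x ((f (psi x) - g (psi x)) * \1_B x).
    rewrite -RintegralD//; [|exact: uBi|exact: (uBi _ fgi)].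
    by apply: eq_Rintegral => x _; rewrite -mulrDl addrC subrK.
  rewrite gE opprD addrACA subrr add0r.
  apply: le_trans (ler_normB _ _) _; rewrite [leRHS]splitr; apply: lerD.
    apply: le_trans fg; have := uhi _ fgi => i.
    apply: le_trans (le_normr_Rintegral measurableT i) _.
    apply: Rintegral_le => //; first exact: Rintegrable_norm.
    by move=> x; rewrite normrM ler_piMr.
  apply: le_trans fg; have := uBi _ fgi => i.
  rewrite -(Rintegral_comp ppsi nfgi).
  apply: le_trans (le_normr_Rintegral measurableT i) _.
  apply: Rintegral_le; [exact: Rintegrable_norm|exact: (Rintegrable_comp ppsi nfgi)|].
  by move=> x; rewrite normrM ler_piMr// norm_indic_le1.
Qed.

End density.

(** * Constancy of limits whose superlevel sets are trivial *)

(** This is the limit superior of the events $\{w_k>t\}$. It ignores any finite number of terms,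
    unlike a superlevel set of a single term. *)
Definition frequently_above {T : Type} {R : realType} (w : nat -> T -> R) (t : R) :=
  [set x | forall N, exists2 k, (N <= k)%N & t < w k x].

Section tail_limit.
Set Implicit Arguments.
Unset Strict Implicit.
Context {R : realType} {d : measure_display} {T : measurableType d}.
Variables (mu : probability T R).

Lemma measurable_frequently_above (w : nat -> T -> R) t :
  (forall k, measurable_fun setT (w k)) -> measurable (frequently_above w t).
Proof.
move=> mw.
have -> : frequently_above w t =
    \bigcap_N \bigcup_(k in [set k | (N <= k)%N]) (w k @^-1` `]t, +oo[).
  apply/seteqP; split=> x H.
    by move=> N _; have [k Nk tk] := H N; exists k => //=; rewrite in_itv/= andbT.
  by move=> N; have [k Nk] := H N I; rewrite /= in_itv/= andbT => tk; exists k.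
apply: bigcapT_measurable => N; apply: bigcup_measurable => k _.
by rewrite -[X in measurable X]setTI; apply: mw.
Qed.

Variable w : nat -> T -> R.
Hypothesis w01 : forall k x, 0 <= w k x <= 1.
Hypothesis mw : forall k, measurable_fun setT (w k).
Hypothesis trivial_w : forall t, fine (mu (frequently_above w t)) = 0 \/
  fine (mu (frequently_above w t)) = 1.
Hypothesis cauchy_w : forall k,
  \int[mu]_x `|w k.+1 x - w k x| <= (2 ^ k.+1)%:R^-1.

Let wi k : Rintegrable mu (w k).
Proof.
apply: (@Rintegrable_bounded _ _ _ _ _ 1) => // x.
by have /andP[? ?] := w01 k x; rewrite ger0_norm.
Qed.

(** The measure of the set decreases as the level grows and is always 0 or 1, so it drops at one
    level: [c] is the supremum of the levels of measure 1. *)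
Lemma frequently_above_threshold e : 0 < e -> exists c,
  fine (mu (frequently_above w (c - e))) = 1 /\
  fine (mu (frequently_above w (c + e))) = 0.
Proof.
move=> e0; pose S := [set t | fine (mu (frequently_above w t)) = 1].
have SN1 : S (-1).
  rewrite /S /= (_ : frequently_above w (-1) = setT).
    by rewrite [X in fine X](@probability_setT _ _ _ mu).
  apply/seteqP; split=> // x _ N; exists N => //.
  by have /andP[? _] := w01 N x; lra.
have S1 : ubound S 1.
  move=> t St; rewrite leNgt; apply/negP => t1; move: St.
  rewrite /S /= (_ : frequently_above w t = set0).
    by rewrite measure0 /= => /eqP; rewrite eq_sym oner_eq0.
  apply/seteqP; split=> // x /(_ 0%N)[k _].
  by have /andP[_ ?] := w01 k x; lra.
have supS : has_sup S by split; [exists (-1)|exists 1].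
exists (sup S); split.
  have [t St et] := sup_adherent e0 supS.
  apply: le_anti; rewrite -{2}St.
  have m s := measurable_frequently_above s mw.
  have /andP[_ ->] /= := fine_probability_le1 mu (m (sup S - e)).
  rewrite fine_le ?fin_num_measure//.
  apply: le_measure; rewrite ?inE//.
  by move=> x xt N; have [k Nk tk] := xt N; exists k => //; exact: lt_trans tk.
have [//|Se] := trivial_w (sup S + e).
have := ub_le_sup supS.2 Se; lra.
Qed.

(** The sum [S] of the increments from index [j] on bounds $|w_k-w_j|$ for all $k\ge j$. Almost
    everywhere some late terms exceed $c-e$ and all late terms are at most $c+e$, hence $|w_j-c|\le
    S+e$; integrating [S] gives a geometric series. *)
Lemma frequently_above_cvg j e : 0 < e ->
  exists c, \int[mu]_x `|w j x - c| <= (2 ^ j)%:R^-1 + e.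
Proof.
move=> e0; have [c [c1 c0]] := frequently_above_threshold e0; exists c.
pose u k x : \bar R := (`|w (j + k).+1 x - w (j + k) x|)%:E.
have u0 k x : (0 <= u k x)%E by rewrite lee_fin.
have mu' k : measurable_fun setT (u k).
  apply/measurable_EFinP; apply: measurableT_comp => //.
  exact: measurable_funB.
pose S x := (\sum_(k <oo) u k x)%E.
have S0 x : (0 <= S x)%E by apply: nneseries_ge0.
have mS : measurable_fun setT S by apply: ge0_emeasurable_sum.
have wS K x : (`|w (j + K)%N x - w j x|%:E <= S x)%E.
  apply: le_trans (nneseries_lim_ge K _); last by [].
  elim: K => [|K IH]; first by rewrite addn0 subrr normr0 big_geq.
  rewrite big_nat_recr//= addnS; apply: le_trans (leeD IH (lexx _)).
  by rewrite -EFinD lee_fin [leRHS]addrC; exact: ler_distD.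
have m s := measurable_frequently_above s mw.
have ae : {ae mu, forall x, setT x -> (`|w j x - c|%:E <= S x + e%:E)%E}.
  exists (~` frequently_above w (c - e) `|` frequently_above w (c + e)); split.
  - by apply: measurableU => //; exact: measurableC.
  - have mn : mu (~` frequently_above w (c - e)) = 0%E.
      rewrite [LHS](probability_setC mu (m _)).
      by rewrite -(fineK (fin_num_measure mu _ (m (c - e)))) c1 subee.
    have mp : mu (frequently_above w (c + e)) = 0%E.
      by rewrite -(fineK (fin_num_measure mu _ (m (c + e)))) c0.
    by rewrite -mn; apply: measureU0; rewrite ?mp//; exact: measurableC.
  move=> x; apply: contra_notP => /not_orP[/contrapT xl xu] _.
  have : (S x = +oo \/ exists s, S x = s%:E)%E.
    by move: (S0 x); case: (S x) => [s|//|//] _; [right; exists s|left].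
  case=> [->|[s Ss]]; first by rewrite addye// leey.
  have ws k : (j <= k)%N -> `|w k x - w j x| <= s.
    by move=> jk; rewrite -lee_fin -Ss -(subnKC jk); exact: wS.
  (* The index [k] yields the lower bound $c-e$, and [maxn j N] the upper bound $c+e$; both are at
     least [j], so [S] controls the distance to [w j]. *)
  have [k /ws] := xl j.
  have /existsNP[N xN] := xu.
  have : w (maxn j N) x <= c + e.
    rewrite leNgt; apply/negP => lt; apply: xN.
    by exists (maxn j N) => //; exact: leq_maxr.
  have := ws _ (leq_maxl j N).
  rewrite Ss -EFinD lee_fin !ler_norml => /andP[? ?] ? /andP[? ?] ?.
  by apply/andP; split; lra.
have ii : Rintegrable mu (fun x => `|w j x - c|).
  by apply: Rintegrable_norm; apply: RintegrableB => //; exact: Rintegrable_cst.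
rewrite -lee_fin EFin_Rintegral//.
apply: le_trans (ae_ge0_le_integral _ _ _ _ _ ae) _ => //.
- by have /integrableP[] := ii.
- by move=> x _; rewrite adde_ge0// lee_fin ltW.
- exact: emeasurable_funD.
rewrite ge0_integralD//; last by move=> x _; rewrite lee_fin ltW.
rewrite integral_cst// [X in (_ * X)%E](@probability_setT _ _ _ mu) mule1 EFinD.
apply: leeD => //; rewrite /S integral_nneseries//.
(* The increment at $j+k$ has norm at most $2^{-j}/2^{k+1}$, and these bounds sum to $2^{-j}$. *)
apply: le_trans (epsilon_trick0 xpredT _); last by rewrite invr_ge0.
apply: lee_nneseries => [k _ _|k _]; first exact: integral_ge0.
rewrite -EFin_Rintegral; last first.
  by apply: Rintegrable_norm; exact: RintegrableB.
rewrite lee_fin; apply: le_trans (cauchy_w _) _.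
by rewrite -addnS expnD natrM invfM.
Qed.

End tail_limit.

(** * From a trivial tail to uniform mixing *)

Section tail_mixing.
Set Implicit Arguments.
Unset Strict Implicit.
Context {R : realType} {d : measure_display} {T : measurableType d}.
Variables (mu : probability T R) (phi : T -> T) (P : (T -> R) -> (T -> R)).
Hypotheses (pphi : measure_preserving mu phi)
  (PF : is_perron_frobenius mu phi P).
Variable B : set T.
Hypothesis mB : measurable B.

Let pn n := measure_preserving_iter n pphi.

Lemma nonincreasing_ge0_cauchy (v : nat -> R) :
  (forall n m, (n <= m)%N -> v m <= v n) -> (forall n, 0 <= v n) ->
  forall e, 0 < e -> exists N, forall n m, (N <= n <= m)%N -> v n - v m <= e.
Proof.
move=> vdec v0 e e0; have infv : has_inf (range v).
  by split; [exists (v 0%N), 0%N|exists 0 => _ [n _ <-]].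
have [_ [N _ <-] Ne] := inf_adherent e0 infv.
exists N => n m /andP[Nn nm].
have : inf (range v) <= v m by apply: ge_inf; [exact: infv.2|exists m].
by have := vdec _ _ Nn; lra.
Qed.

Section densities.
Variable h : nat -> T -> R.
Hypotheses (mh : forall n, measurable_fun setT (h n))
  (h01 : forall n x, 0 <= h n x <= 1)
  (hE : forall n A, measurable A -> \int[mu]_x (h n x * \1_A x) =
    \int[mu]_x (\1_B x * \1_A (iter n phi x))).

Let f n x := h n (iter n phi x).

Let hi n : Rintegrable mu (h n).
Proof.
apply: (@Rintegrable_bounded _ _ _ _ _ 1) => // x.
by have /andP[? ?] := h01 n x; rewrite ger0_norm.
Qed.

Let hM n u : Rintegrable mu u -> Rintegrable mu (fun x => u x * h n x).
Proof.
move=> ui; apply: (@RintegrableM _ _ _ _ _ _ 1) => // x.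
by have /andP[? ?] := h01 n x; rewrite ger0_norm.
Qed.

Let fi n : Rintegrable mu (f n).
Proof. exact: Rintegrable_comp. Qed.

Let mf n : measurable_fun setT (f n).
Proof. exact: Rintegrable_measurable (fi n). Qed.

Let f01 n x : 0 <= f n x <= 1. Proof. exact: h01. Qed.

Let fM n u : Rintegrable mu u -> Rintegrable mu (fun x => u x * f n x).
Proof.
move=> ui; apply: (@RintegrableM _ _ _ _ _ _ 1) => // x.
by have /andP[? ?] := f01 n x; rewrite ger0_norm.
Qed.

(** By [Rintegral_density_mul] with equal indices, this is the squared $L^2$ norm of [f n]. *)
Let v n := \int[mu]_x (f n x * \1_B x).

(** For $n\le m$ the function [f m] factors through [iter n phi], so duality lets [\1_B] replace
    [f n]. *)
Lemma Rintegral_density_mul n m : (n <= m)%N ->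
  \int[mu]_x (f m x * f n x) = v m.
Proof.
move=> nm; pose u x := h m (iter (m - n) phi x).
have fmE x : f m x = u (iter n phi x) by rewrite /f /u -iterD subnK.
have ui : Rintegrable mu u by exact: (Rintegrable_comp (pn _) (hi _)).
transitivity (\int[mu]_x (u x * h n x)).
  rewrite -(Rintegral_comp (pn n) (hM n ui)).
  by apply: eq_Rintegral => x _; rewrite fmE.
rewrite (density_duality (pn n) mB (mh n) (h01 n) (@hE n) ui).
by apply: eq_Rintegral => x _; rewrite fmE.
Qed.

(** This is Pythagoras: in the expanded square the cross term and the square of [f m] both integrate
    to [v m]. *)
Lemma Rintegral_density_sqr n m : (n <= m)%N ->
  \int[mu]_x ((f m x - f n x) ^+ 2) = v n - v m.
Proof.
move=> nm.
have mm := fM m (fi m); have nn := fM n (fi n); have mn := fM n (fi m).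
rewrite -{1}(Rintegral_density_mul (leqnn n)).
transitivity (\int[mu]_x (f m x * f m x) + \int[mu]_x (f n x * f n x)
    - 2 * \int[mu]_x (f m x * f n x)).
  rewrite -(RintegralZl 2 measurableT mn) -RintegralD// -RintegralB//.
  - by apply: eq_Rintegral => x _; ring.
  - exact: RintegrableD mm nn.
  - exact: (RintegrableZ 2 mn).
rewrite (Rintegral_density_mul nm) (Rintegral_density_mul (leqnn m)).
ring.
Qed.

Lemma density_cauchy e : 0 < e -> exists N, forall n m, (N <= n <= m)%N ->
  \int[mu]_x `|f m x - f n x| <= e.
Proof.
move=> e0; have v_ge0 n : 0 <= v n.
  apply: Rintegral_ge0 => x _; have /andP[? _] := f01 n x.
  by rewrite mulr_ge0// indicE.
have v_dec n m : (n <= m)%N -> v m <= v n.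
  move=> nm; rewrite -subr_ge0 -Rintegral_density_sqr//.
  by apply: Rintegral_ge0 => x _; exact: sqr_ge0.
(* The tolerance is $e^2$ because $L^1$ is reached through $z\le e/2+z^2/(2e)$, whose last term then
   contributes at most $e/2$. *)
have [N NP] := nonincreasing_ge0_cauchy v_dec v_ge0 (exprn_gt0 2 e0).
exists N => n m Nnm; have nm : (n <= m)%N by case/andP : Nnm.
have fmn := RintegrableB (fi m) (fi n).
have sqi : Rintegrable mu (fun x => (f m x - f n x) ^+ 2).
  apply: (@RintegrableM _ _ _ _ _ _ 1) => //.
    exact: Rintegrable_measurable fmn.
  move=> x; have := f01 m x; have := f01 n x; rewrite ler_norml; lra.
have sqi' : Rintegrable mu (fun x => (2 * e)^-1 * (f m x - f n x) ^+ 2).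
  exact: RintegrableZ sqi.
apply: (@le_trans _ _ (\int[mu]_x (e / 2 + (2 * e)^-1 * (f m x - f n x) ^+ 2))).
  apply: Rintegral_le => [||x]; first exact: Rintegrable_norm.
    exact: (RintegrableD (Rintegrable_cst _ _) sqi').
  rewrite -[(f m x - _) ^+ 2]real_normK ?num_real// -subr_ge0.
  set z := `|_|.
  have -> : e / 2 + (2 * e)^-1 * z ^+ 2 - z = (2 * e)^-1 * (z - e) ^+ 2.
    by field; rewrite gt_eqF.
  by rewrite mulr_ge0 ?sqr_ge0// invr_ge0 mulr_ge0// ltW.
rewrite RintegralD//; last exact: Rintegrable_cst.
rewrite Rintegral_const RintegralZl// Rintegral_density_sqr//.
have : (2 * e)^-1 * (v n - v m) <= e / 2.
  rewrite mulrC ler_pdivrMr ?mulr_gt0//.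
  by have := NP _ _ Nnm; rewrite expr2; lra.
lra.
Qed.

(** Only indices $k\ge n$ matter for an infinitely-often event, and for these $s(k)\ge n$, so
    [f (s k)] factors through [iter n phi]. *)
Lemma density_tail_event s t : (forall k, (k <= s k)%N) ->
  tail_event phi (frequently_above (fun k => f (s k)) t).
Proof.
(* When $s(k)<n$ the truncated subtraction gives 0 and [w k] is an arbitrary placeholder; [maxn n N]
   below avoids such [k]. *)
move=> ks n; pose w k y := h (s k) (iter (s k - n) phi y).
exists (frequently_above w t).
  apply: measurable_frequently_above => k.
  exact: Rintegrable_measurable (Rintegrable_comp (pn _) (hi _)).
have fw k x : (n <= k)%N -> f (s k) x = w k (iter n phi x).
  by move=> nk; rewrite /w /f -iterD subnK// (leq_trans nk).
apply/seteqP; split=> x xt N; have [k] := xt (maxn n N);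
  rewrite geq_max => /andP[nk Nk] tk; exists k => //.
- by rewrite -fw.
- by rewrite fw.
Qed.

Lemma density_cvg :
  (forall E, tail_event phi E -> fine (mu E) = 0 \/ fine (mu E) = 1) ->
  forall e, 0 < e -> exists N, forall n, (N <= n)%N ->
    \int[mu]_x `|h n x - fine (mu B)| <= e.
Proof.
move=> tail01 e e0.
have pk k : 0 < (2 ^ k.+1)%:R^-1 :> R by rewrite invr_gt0 ltr0n expn_gt0.
have [N NP] := choice (fun k => density_cauchy (pk k)).
(* Partial sums make [s] nondecreasing and at least [N k]; the added 1 in each term makes it at
   least [k]. *)
pose s k := (\sum_(i < k.+1) (N i).+1)%N.
have ss k : (s k <= s k.+1)%N by rewrite /s [X in (_ <= X)%N]big_ord_recr leq_addr.
have ks k : (k <= s k)%N.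
  by rewrite -[X in (X <= _)%N]muln1 -[X in (X * _)%N]card_ord -sum_nat_const /s
    big_ord_recr/= (leq_trans _ (leq_addr _ _))// leq_sum.
have Ns k : (N k <= s k)%N.
  by rewrite /s big_ord_recr/= (leq_trans (leqnSn _))// leq_addl.
(* The error budget is [e / 4] from [f (s j)] to [c], [e / 4] from [c] to $\mu(B)$, and at most
   [e / 16] from [f n] to [f (s j)]. *)
have [j je] : exists j, (2 ^ j)%:R^-1 <= e / 8 :> R.
  exists (Num.truncn (e / 8)^-1).+1.
  rewrite -[leRHS]invrK lef_pV2 ?posrE ?invr_gt0 ?divr_gt0 ?ltr0n ?expn_gt0//.
  apply: le_trans (ltW (truncnS_gt _)) _.
  by rewrite ler_nat ltnW// ltn_expl.
have [c cP] : exists c, \int[mu]_x `|f (s j) x - c| <= (2 ^ j)%:R^-1 + e / 8.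
  apply: (@frequently_above_cvg _ _ _ mu (fun k => f (s k))) => //.
  - by move=> t; apply: tail01; exact: density_tail_event.
  - by move=> k; apply: NP; rewrite Ns ss.
  - by rewrite divr_gt0.
have fmean n : \int[mu]_x f n x = fine (mu B).
  rewrite [LHS](Rintegral_comp (pn n) (hi n)) -Rintegral_indic//.
  transitivity (\int[mu]_x (h n x * \1_setT x)).
    by apply: eq_Rintegral => x _; rewrite indicT mulr1.
  by rewrite hE//; apply: eq_Rintegral => x _; rewrite indicT mulr1.
have ci k : Rintegrable mu (fun x => f (s j) x - k).
  by apply: RintegrableB => //; exact: Rintegrable_cst.
(* Every [f n] has mean $\mu(B)$, so $L^1$ closeness to the constant [c] identifies [c] up to the
   same error. *)
have cB : `|fine (mu B) - c| <= e / 4.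
  have -> : fine (mu B) - c = \int[mu]_x (f (s j) x - c).
    have := RintegralB measurableT (fi (s j)) (Rintegrable_cst mu c).
    by rewrite Rintegral_const fmean => ->.
  by apply: le_trans (le_normr_Rintegral measurableT (ci c)) _; lra.
exists (s j) => n sn.
have hBi : Rintegrable mu (fun x => `|h n x - fine (mu B)|).
  by apply: Rintegrable_norm; apply: RintegrableB => //; exact: Rintegrable_cst.
rewrite -(Rintegral_comp (pn n) hBi) -/(f n _).
have fni := Rintegrable_norm (RintegrableB (fi n) (fi (s j))).
have cci := Rintegrable_norm (ci c).
apply: (@le_trans _ _ (\int[mu]_x (`|f n x - f (s j) x| + `|f (s j) x - c| + e / 4))).
  apply: Rintegral_le => [||x].
  - exact: (Rintegrable_comp (pn n) hBi).
  - by apply: RintegrableD; [exact: RintegrableD|exact: Rintegrable_cst].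
  have := ler_distD (f (s j) x) (f n x) (fine (mu B)).
  have := ler_distD c (f (s j) x) (fine (mu B)).
  by move: cB; rewrite (distrC c) /f; lra.
rewrite RintegralD//; [|exact: RintegrableD|exact: Rintegrable_cst].
rewrite RintegralD// Rintegral_const.
have : \int[mu]_x `|f n x - f (s j) x| <= (2 ^ j.+1)%:R^-1.
  by apply: NP; rewrite Ns sn.
rewrite expnS natrM invfM; lra.
Qed.

End densities.

(** The correlation is the integral of $h_n-\mu(B)$ over [A], hence at most its $L^1$ norm whatever
    [A] is, and [density_cvg] makes that norm small. *)
Lemma tail_trivial_uniformly_mixing :
  (forall E, tail_event phi E -> fine (mu E) = 0 \/ fine (mu E) = 1) ->
  uniformly_mixing mu phi measurable \1_B.
Proof.
move=> tail01 e e0.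
have [h hP] := choice (fun n => perron_frobenius_density (pn n)
  (is_perron_frobenius_iter n pphi PF) mB).
have mh n : measurable_fun setT (h n) by case: (hP n).
have h01 n x : 0 <= h n x <= 1 by case: (hP n).
have hE n A : measurable A -> \int[mu]_x (h n x * \1_A x) =
    \int[mu]_x (\1_B x * \1_A (iter n phi x)) by case: (hP n) => _ _; exact.
have [N NP] := density_cvg mh h01 hE tail01 e0.
exists N => n A Nn mA; apply: le_trans (NP n Nn).
have hi : Rintegrable mu (h n).
  apply: (@Rintegrable_bounded _ _ _ _ _ 1) => // x.
  by have /andP[? ?] := h01 n x; rewrite ger0_norm.
have hBi : Rintegrable mu (fun x => h n x - fine (mu B)).
  by apply: RintegrableB => //; exact: Rintegrable_cst.
have hBAi := RintegrableM_indic hBi mA.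
have -> : correlation mu (iter n phi) \1_B A =
    \int[mu]_x ((h n x - fine (mu B)) * \1_A x).
  rewrite /correlation -hE// (Rintegral_indic mu mB) [_ * fine (mu B)]mulrC.
  rewrite -(Rintegral_indic mu mA).
  rewrite -RintegralZl//; last exact: Rintegrable_indic.
  rewrite -RintegralB//; first by apply: eq_Rintegral => x _; rewrite mulrBl.
    exact: RintegrableM_indic.
  by apply: RintegrableZ; exact: Rintegrable_indic.
apply: le_trans (le_normr_Rintegral measurableT hBAi) _.
apply: Rintegral_le => [||x]; [exact: Rintegrable_norm..|].
by rewrite normrM ler_piMr// norm_indic_le1.
Qed.

End tail_mixing.

Theorem theorem2p2 (R : realType) (d : measure_display) (T : measurableType d)
  (mu : probability T R) (phi : T -> T) (P : (T -> R) -> (T -> R))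
  (hphi : measure_preserving mu phi) (hP : is_perron_frobenius mu phi P) :
  let exact :=
    forall f : T -> R, mu.-integrable setT (EFin \o f) ->
      (fun n : nat =>
         (\int[mu]_x (`| iter n P f x - fine (\int[mu]_y (f y)%:E)%E |)%:E)%E)
        @ \oo --> 0%E in
  let mixing (S : set (set T)) (B : set T) :=
    (fun n : nat =>
       ereal_sup [set `| mu (iter n phi @^-1` A `&` B) - mu A * mu B |%E
                 | A in S]) @ \oo --> 0%E in
  (exact <-> (forall B, measurable B -> mixing measurable B)) /\
  ((forall B, measurable B -> mixing measurable B) <->
   (forall B, measurable B -> exists D, measurable D /\ (0 < mu D)%E /\
        mixing [set A `&` D | A in measurable] B)).
Proof.
move=> exact mixing.
have mixP B : measurable B ->
    mixing measurable B <-> uniformly_mixing mu phi measurable \1_B.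
  by move=> mB; apply: mixing_uniformly_mixing.
have mixDP B D : measurable B -> measurable D ->
    mixing [set A `&` D | A in measurable] B <->
    uniformly_mixing mu phi [set A `&` D | A in measurable] \1_B.
  move=> mB mD; apply: mixing_uniformly_mixing => //.
    by exists set0; rewrite ?set0I.
  by move=> _ [A mA <-]; exact: measurableI.
split; split.
- move=> ex B mB; apply/mixP => //.
  have Bi := Rintegrable_indic mu mB.
  by apply/(exact_uniformly_mixing hphi hP Bi)/ex.
- move=> mix f fi; apply/(exact_uniformly_mixing hphi hP fi).
  by apply: uniformly_mixing_integrable => // B mB; exact/mixP/mix.
- move=> mix B mB; exists setT; split=> //; split.
    by rewrite [X in (_ < X)%E](@probability_setT _ _ _ mu).
  apply/mixDP => // e e0; have [N NP] := (mixP _ mB).1 (mix _ mB) e e0.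
  by exists N => n _ Nn [A mA <-]; rewrite setIT; exact: NP.
(* Condition (iii) is applied to each tail event [E] rather than to [B], with a set [D] depending on
   [E]; the resulting triviality of the tail gives mixing for [B]. *)
move=> mixD B mB; apply/mixP => //.
apply: (tail_trivial_uniformly_mixing hphi hP mB) => E tE.
apply: (tail_event_trivial hphi tE).
have mE : measurable E by have [C mC ->] := tE 0%N; exact: mC.
have [D [mD [D0 mixE]]] := mixD _ mE.
by exists D; split=> //; exact/mixDP.
Qed.
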